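(* Let $G$ be a locally compact second-countable Hausdorff topological group and let $X$ be a locally compact second-countable metric space. Let $S\subset C_s(G,X)$ be $\sigma$-invariant. Then $S$ satisfies the compactness axiom, the existence axiom and the uniqueness axiom (on $G\times X$) and has domain $G$ if and only if there is a continuous left $G$-action $\pi_S:G\times X\to X$ on $X$ such that $$S=\{\pi_S(\cdot,x)\mid x\in X\}.$$
   Context: A partial map from $G$ to $X$ is a continuous map $\phi:D\to X$ with $D\subset G$ nonempty and open; $\mathrm{dom}\,\phi:=D$. The set $C_p(G,X)$ of partial maps has the topology with subbasis the sets $W(K,U)=\{\phi\mid K\subset\mathrm{dom}\,\phi,\ \phi(K)\subset U\}$, $K\subset G$ compact, $U\subset X$ open. A partial map $\phi$ with nonempty connected domain is maximally defined if, for every partial map $\psi$ with nonempty connected domain, $\mathrm{dom}\,\phi\subset\mathrm{dom}\,\psi$ and $\phi=\psi$ on $\mathrm{dom}\,\phi$ imply $\phi=\psi$. $C_s(G,X)\subset C_p(G,X)$ is the subspace of maximally defined partial maps. For $S\subset C_s(G,X)$ and $W\subset G\times X$, $S^*W:=\{(g,\phi)\mid\phi\in S,\ g\in\mathrm{dom}\,\phi,\ (g,\phi(g))\in W\}$, with the subspace topology from $G\times C_s(G,X)$. $S$ satisfies the compactness axiom if $S^*W$ is compact for all compact $W\subset G\times X$; the existence axiom on $W$ if $S^*\{(t,x)\}$ is nonempty for all $(t,x)\in W$; the uniqueness axiom on $W$ if $S^*\{(t,x)\}$ is empty or a singleton for all $(t,x)\in W$. $S$ has domain $D$ if $D\subset\mathrm{dom}\,\phi$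 for all $\phi\in S$. The shift map $\sigma:G\times C_p(G,X)\to C_p(G,X)$ is $\sigma(g,\phi)(x):=\phi(xg)$ for $x\in\mathrm{dom}(\phi)g^{-1}$. $S$ is $\sigma$-invariant if $\sigma(g,\phi)\in S$ for all $g\in G$, $\phi\in S$. *)

(* Defs.v *)
From HB Require Import structures.
From mathcomp Require Import all_boot all_order all_algebra.
From mathcomp Require Import all_classical all_reals all_analysis.

Set Implicit Arguments.
Unset Strict Implicit.
Unset Printing Implicit Defensive.

Local Open Scope classical_set_scope.

(* Not necessarily abelian; no separation axiom is built in. *)
HB.mixin Record isTopologicalGroup G & Topological G & Group G := {
  mulg_continuous : continuous (fun p : G * G => (p.1 * p.2)%g) ;
  invg_continuous : continuous (fun g : G => (g^-1)%g)
}.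

#[short(type="topologicalGroupType")]
HB.structure Definition TopologicalGroup :=
  {G of Topological G & Group G & isTopologicalGroup G}.

Section PartialMap.
Context {G X : topologicalType}.

(* [pfun] is a function on the subtype [pdom], which carries the subspace
   topology.  Equality of partial maps is Leibniz equality: by propositional
   and functional extensionality it means same domain and same values. *)
Record partial_map := PartialMap {
  pdom : set G ;
  pfun :> pdom -> X ;
  pdom_neq0 : pdom !=set0 ;
  pdom_open : open pdom ;
  pfun_continuous : continuous pfun
}.

HB.instance Definition _ := gen_eqMixin partial_map.
HB.instance Definition _ := gen_choiceMixin partial_map.

(* W(K, U), the generator of the topology of C_p(G, X). *)
Definition subbase_set (KU : set G * set X) : set partial_map :=
  [set phi | KU.1 `<=` pdom phi /\ phi @` [set g | KU.1 (\val g)] `<=` KU.2].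

HB.instance Definition _ := isSubBaseTopological.Build partial_map
  [set KU : set G * set X | compact KU.1 /\ open KU.2] subbase_set.

Definition extended_by (phi psi : partial_map) :=
  pdom phi `<=` pdom psi /\
  forall (g : pdom phi) (h : pdom psi), \val g = \val h -> phi g = psi h.

Definition maximally_defined (phi : partial_map) :=
  connected (pdom phi) /\
  forall psi, connected (pdom psi) -> extended_by phi psi -> phi = psi.

(* C_s(G, X), as a subset of C_p(G, X) = [partial_map]. *)
Definition maximal_partial_maps : set partial_map :=
  [set phi | maximally_defined phi].

Implicit Types (S : set partial_map) (W : set (G * X)).

Definition star S W : set (G * partial_map) :=
  [set p | S p.2 /\
    exists2 g : pdom p.2, \val g = p.1 & W (p.1, (p.2 : partial_map) g)].

(* Compactness of a subset depends only on its subspace topology, so whether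
   [star S W] is regarded inside G * C_p(G, X) or inside G * C_s(G, X) is
   immaterial when S `<=` C_s(G, X). *)
Definition compactness_axiom S :=
  forall W : set (G * X), compact W -> compact (star S W).

Definition existence_axiom S W :=
  forall t x, W (t, x) -> star S [set (t, x)] !=set0.

Definition uniqueness_axiom S W :=
  forall t x, W (t, x) ->
    star S [set (t, x)] = set0 \/ exists p, star S [set (t, x)] = [set p].

Definition has_domain S (D : set G) := forall phi, S phi -> D `<=` pdom phi.

End PartialMap.

Arguments partial_map : clear implicits.
Arguments maximal_partial_maps : clear implicits.

Section Shift.
Context {G : topologicalGroupType} {X : topologicalType}.
Variables (g : G) (phi : partial_map G X).

Definition shift_dom : set G := [set x | pdom phi (x * g)%g].

Lemma shift_domE : shift_dom = [set (y * g^-1)%g | y in pdom phi].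
Proof.
apply/seteqP; split => [x xg|_ [y yphi <-]].
  by exists (x * g)%g => //; rewrite mulgK.
by rewrite /shift_dom/= mulgVK.
Qed.

Lemma shift_arg_subproof (x : shift_dom) : (\val x * g)%g \in pdom phi.
Proof. by case: x => x /= /set_mem ?; apply/mem_set. Qed.

Definition shift_arg (x : shift_dom) : pdom phi := SigSub (shift_arg_subproof x).

Lemma mulgr_continuous : continuous (fun x : G => (x * g)%g).
Proof.
move=> x; apply: (@continuous_comp _ _ _ (fun y => (y, g)) (fun p => (p.1 * p.2)%g)).
  by apply: cvg_pair; [exact: cvg_id|exact: cvg_cst].
exact: mulg_continuous.
Qed.

Lemma shift_arg_continuous : continuous shift_arg.
Proof.
apply: continuous_comp_initial => x.
apply: (@continuous_comp _ _ _ set_val (fun x : G => (x * g)%g)).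
  exact: initial_continuous.
exact: mulgr_continuous.
Qed.

Lemma shift_dom_neq0 : shift_dom !=set0.
Proof.
by have [y yphi] := pdom_neq0 phi; exists (y * g^-1)%g; rewrite /shift_dom/= mulgVK.
Qed.

Lemma shift_dom_open : open shift_dom.
Proof.
by apply: open_comp (pdom_open phi) => x _; exact: mulgr_continuous.
Qed.

Lemma shift_fun_continuous : continuous (phi \o shift_arg).
Proof.
move=> x; apply: continuous_comp; first exact: shift_arg_continuous.
exact: pfun_continuous.
Qed.

Definition shift_map : partial_map G X :=
  PartialMap shift_dom_neq0 shift_dom_open shift_fun_continuous.

End Shift.

Definition shift_invariant {G : topologicalGroupType} {X : topologicalType}
    (S : set (partial_map G X)) :=
  forall g phi, S phi -> S (shift_map g phi).

Record continuous_left_action (G : topologicalGroupType)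
    (X : topologicalType) := ContinuousLeftAction {
  act :> G * X -> X ;
  act_continuous : continuous act ;
  act1 : forall x, act (1%g, x) = x ;
  actM : forall g h x, act ((g * h)%g, x) = act (g, act (h, x))
}.

Section OrbitMap.
Context {G : topologicalGroupType} {X : topologicalType}.
Variables (pi : continuous_left_action G X) (x : X).

Lemma orbit_dom_neq0 : [set: G] !=set0.
Proof. by exists 1%g. Qed.

Lemma orbit_fun_continuous :
  continuous (fun g : [set: G] => pi (\val g, x)).
Proof.
move=> g; apply: (@continuous_comp _ _ _ set_val (fun h : G => pi (h, x))).
  exact: initial_continuous.
apply: (@continuous_comp _ _ _ (fun h => (h, x)) pi).
  by apply: cvg_pair; [exact: cvg_id|exact: cvg_cst].
exact: act_continuous.
Qed.

(* pi(., x), with domain all of G. *)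
Definition orbit_map : partial_map G X :=
  PartialMap orbit_dom_neq0 openT orbit_fun_continuous.

End OrbitMap.

(* Main.v *)
(* A set S satisfying the axioms is parametrized by X through s x, the unique
   element of S with value x at 1.  For a compact neighbourhood B of x the set
   S^*({1} x B) = {(1, s y) | y in B} is compact, and evaluation at 1 maps it
   bijectively and continuously onto the Hausdorff space B, so s is continuous.
   As G is locally compact Hausdorff, evaluation of partial maps is jointly
   continuous, hence so is pi(g, x) := s x g; shift invariance and uniqueness
   make it an action.  Conversely, for an action pi, S^*W is the image of W
   under (g, x) |-> (g, pi(., g^-1 x)), which is continuous by the tube lemma. *)

Require Import Defs.
From mathcomp Require Import all_boot all_order all_algebra finmap.
From mathcomp Require Import all_classical all_reals all_analysis.

Local Open Scope classical_set_scope.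

Lemma continuous_pair {T U V : topologicalType} (f : T -> U) (g : T -> V) :
  continuous f -> continuous g -> continuous (fun t => (f t, g t)).
Proof. by move=> cf cg t; apply: cvg_pair; [exact: cf|exact: cg]. Qed.

(** * Graphs, neighbourhoods in the space of partial maps, and evaluation *)

Section Graph.
Context {G X : topologicalType}.
Implicit Types (phi psi : partial_map G X) (S : set (partial_map G X)).

(* Relational view of evaluation, which avoids elements of the subtype
   [pdom phi] in statements relating partial maps with different domains. *)
Definition graph phi : set (G * X) :=
  [set p | exists2 g : pdom phi, \val g = p.1 & phi g = p.2].

Lemma graph_val phi (g : pdom phi) : graph phi (\val g, phi g).
Proof. by exists g. Qed.

Lemma graph_dom phi g x : graph phi (g, x) -> pdom phi g.
Proof. by case=> -[h hphi] /= hg _; rewrite -hg; exact: set_mem. Qed.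

Lemma graph_total {phi g} : pdom phi g -> exists x, graph phi (g, x).
Proof.
move=> /mem_set gphi; exists (phi (SigSub gphi)).
by exists (SigSub gphi).
Qed.

Lemma graph_fun {phi g x y} : graph phi (g, x) -> graph phi (g, y) -> x = y.
Proof.
move=> [h /= hg <-] [k /= kg <-]; congr (phi _); apply: val_inj;
exact: etrans hg (esym kg).
Qed.

Lemma graph_inj {phi psi} : graph phi = graph psi -> phi = psi.
Proof.
move=> e; have ed : pdom phi = pdom psi.
  by apply/seteqP; split=> g /graph_total[x]; [rewrite e|rewrite -e] => /graph_dom.
case: phi psi ed e => [D f n o c] [D' f' n' o' c'] /= ed e.
move: f' n' o' c' e; case: _ / ed => f' n' o' c' e.
have ff' : f = f'.
  apply/funext => g.
  have := graph_val (PartialMap n o c) g; rewrite e => -[h /= /val_inj ->].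
  exact.
move: c' {e}; case: _ / ff' => c'.
by congr PartialMap; exact: Prop_irrelevance.
Qed.

Lemma subbase_setP (K : set G) (U : set X) phi :
  subbase_set (K, U) phi <-> forall g, K g -> exists2 x, U x & graph phi (g, x).
Proof.
split=> [[/= Kphi phiU] g Kg|KU].
  have [x gx] := graph_total (Kphi _ Kg); exists x => //.
  by apply: phiU; case: gx => h /= hg hx; exists h => //=; rewrite hg.
split=> [g /KU[x _ /graph_dom]//|_ [h /= Kh] <-].
by have [x Ux /(graph_fun (graph_val _ _))->] := KU _ Kh.
Qed.

Lemma starP S W g phi :
  star S W (g, phi) <-> S phi /\ exists2 x, W (g, x) & graph phi (g, x).
Proof.
split=> [[/= Sphi [h <- Wh]]|[Sphi [x Wx [h /= hg hx]]]]; split=> //=.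
  by exists (phi h) => //; exact: graph_val.
by exists h => //; rewrite hx.
Qed.

Lemma open_subbase_set (K : set G) (U : set X) :
  compact K -> open U -> open (subbase_set (K, U) : set (partial_map G X)).
Proof.
move=> cK oU.
exists [set subbase_set (K, U)]; last by rewrite bigcup_set1.
move=> _ ->; exists (fset1 (K, U)); last by rewrite set_fset1 bigcap_set1.
by move=> KU; rewrite !inE => /eqP ->.
Qed.

Lemma cvg_partial_map {T : Type} {F : set_system T} {FF : Filter F}
    (f : T -> partial_map G X) phi :
  (forall K U, compact K -> open U -> subbase_set (K, U) phi ->
     \forall t \near F, subbase_set (K, U) (f t)) ->
  f @ F --> phi.
Proof.
move=> fphi A; rewrite nbhsE => -[_ [[E EI <-] [B EB Bphi] BA]].
suff : \forall t \near F, B (f t).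
  by apply: filterS => t Bt; apply: BA; exists B.
have [D DI BE] := EI _ EB; rewrite -BE in Bphi *.
apply: filter_bigI => -[K U] KUD; have /set_mem[/= cK oU] := DI _ KUD.
exact: fphi (Bphi _ KUD).
Qed.

(** A locally compact Hausdorff group is regular at [g], so a closed neighbourhood of [g] fits
    inside the part of the domain sent into [U]; cutting it down by a compact neighbourhood gives
    [L]. The subbasic set of [(L, U)] is then what makes evaluation jointly continuous. *)
Lemma partial_map_compact_nbhs {phi g x} {U : set X} :
  locally_compact [set: G] -> hausdorff_space G ->
  graph phi (g, x) -> nbhs x U ->
  exists L, [/\ compact L, nbhs g L & subbase_set (L, U) phi].
Proof.
move=> lcG hG [h /= <- <-] Uh.
have [_ [[V oV <-] Vh VU]] : exists B, [/\ open B, B h & B `<=` phi @^-1` U].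
  have : nbhs h (phi @^-1` U) by exact: pfun_continuous.
  by rewrite nbhsE => -[B [oB Bh] BU]; exists B.
have [B] := lcG (\val h) I; rewrite withinET => hB [cB clB].
(* [V] is open in [G] and only its trace on the domain is controlled by [phi], hence the
   intersection with [pdom phi]. *)
have [R hR RV] : exists2 R, nbhs (\val h) R & closure R `<=` V `&` pdom phi.
  apply: (compact_regular hG cB hB); apply: filterI; apply: open_nbhs_nbhs.
    by split.
  by split; [exact: pdom_open|case: h {hB Vh Uh} => h /= /set_mem].
exists (B `&` closure R); split.
- by apply: compact_closedI => //; exact: closed_closure.
- by apply: filterI => //; apply: filterS hR; exact: subset_closure.
- split=> [k [_ /RV[]]//|_ [k /= [_ /RV[Vk _]] <-]].
  exact: VU.
Qed.

Lemma evaluation_continuous {Y : topologicalType} (s : Y -> partial_map G X)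
    (f : G * Y -> X) :
  locally_compact [set: G] -> hausdorff_space G -> continuous s ->
  (forall g y, graph (s y) (g, f (g, y))) -> continuous f.
Proof.
move=> lcG hG cs sf [g y] U.
rewrite nbhsE => -[V [oV Vf] VU].
have [L [cL gL syL]] := partial_map_compact_nbhs lcG hG (sf g y)
  (open_nbhs_nbhs (conj oV Vf)).
have : \forall z \near y, subbase_set (L, V) (s z).
  by apply: cs; apply: open_nbhs_nbhs; split=> //; exact: open_subbase_set.
move=> yL; exists (L, [set z | subbase_set (L, V) (s z)]) => //= -[h z] /= [Lh].
move=> /subbase_setP/(_ _ Lh)[x Vx /(graph_fun (sf _ _)) E].
by apply: VU; rewrite E.
Qed.

(** This is the inverse of a continuous bijection from a compact space onto a Hausdorff one.
    Compactness is used as a near-covering property: a condition on [y] checked near each point of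
    the star holds on the whole star for all [y] near [x]. *)
Lemma compact_section_continuous S (e : G) (s : X -> partial_map G X) :
  locally_compact [set: X] -> hausdorff_space X ->
  compactness_axiom S ->
  (forall phi psi x, S phi -> S psi -> graph phi (e, x) -> graph psi (e, x) ->
     phi = psi) ->
  (forall x, S (s x)) -> (forall x, graph (s x) (e, x)) -> continuous s.
Proof.
move=> lcX hX cS uS Ss se x; apply: cvg_partial_map => K U cK oU sxKU.
have [B] := lcX x I; rewrite withinET => xB [cB clB].
have cC : compact (star S ([set e] `*` B)).
  by apply: cS; apply: compact_setX => //; exact: compact_set1.
(* Near (e, s z) with z <> x, no (e, s y) with y close to x occurs, so [P] holds
   vacuously there; near (e, s x) it holds because W(K, U) is open. *)
pose P y (p : G * partial_map G X) := p = (e, s y) -> subbase_set (K, U) (s y).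
have : \forall y \near x, star S ([set e] `*` B) `<=` P y.
  move/compact_near_coveringP: cC; apply => -[g phi].
  move=> /starP[Sphi [z [/= -> Bz] ez]].
  have -> : phi = s z by exact: (uS _ _ z).
  have [->|zx] := eqVneq z x.
    exists ([set p | subbase_set (K, U) p.2], setT) => /=.
      split; last exact: filterT.
      exists (setT, subbase_set (K, U)) => /=; last by move=> [? ?] [].
      split; first exact: filterT.
      by apply: open_nbhs_nbhs; split => //; exact: open_subbase_set.
    by move=> [p y] [/= + _] pE; rewrite pE.
  move: hX; rewrite open_hausdorff => /(_ _ _ zx)[[V V'] /=].
  move=> [/set_mem Vz /set_mem V'x] [oV oV' /eqP VV'].
  (* Evaluation at [e] is continuous because [{e}] is compact: [s y] in this open set forces [y]
     into [V], which is disjoint from [V']. *)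
  exists ([set p | subbase_set ([set e], V) p.2], V') => /=.
    split; last by apply: open_nbhs_nbhs; split.
    exists (setT, subbase_set ([set e], V)) => /=; last by move=> [? ?] [].
    split; first exact: filterT.
    apply: open_nbhs_nbhs; split.
      by apply: open_subbase_set => //; exact: compact_set1.
    by apply/subbase_setP => _ ->; exists z.
  move=> [p y] [/= + V'y] pE; rewrite pE => /subbase_setP/(_ _ erefl)[w Vw].
  move=> /(graph_fun (se y)) yw; rewrite -{w}yw in Vw.
  by have : (V `&` V') y by []; rewrite VV'.
apply: filterS2 xB => y By /(_ (e, s y)); apply=> //.
by apply/starP; split=> //; exists y.
Qed.

End Graph.

(** * Orbit maps of an action, and the action built from the axioms *)

Section Action.
Context {G : topologicalGroupType} {X : topologicalType}.
Implicit Types (pi : continuous_left_action G X) (S : set (partial_map G X)).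

Lemma graph_shift h (phi : partial_map G X) g x :
  graph (shift_map h phi) (g, x) <-> graph phi ((g * h)%g, x).
Proof.
split=> [[k /= <- <-]|[k /= kg <-]]; first by exists (shift_arg k).
have gd : g \in shift_dom h phi.
  by apply/mem_set; rewrite /shift_dom /= -kg; exact: set_mem (valP k).
by exists (SigSub gd) => //=; congr (phi _); apply: val_inj; rewrite /= kg.
Qed.

Lemma graph_orbit_map pi x g y : graph (orbit_map pi x) (g, y) <-> y = pi (g, x).
Proof.
split=> [[k /= <- <-]//|->].
by exists (SigSub (mem_set I : g \in [set: G])).
Qed.

(** Tube lemma: the open preimage of [U] under [pi] contains [K] times [{x}], hence [K] times a
    neighbourhood of [x]. *)
Lemma orbit_map_continuous pi : continuous (orbit_map pi).
Proof.
move=> x; apply: cvg_partial_map => K U cK oU /subbase_setP xKU.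
pose P y g := U (pi (g, y)).
have : \forall y \near x, K `<=` P y.
  move/compact_near_coveringP: cK; apply => g /xKU[y Uy /graph_orbit_map yE].
  rewrite {y}yE in Uy.
  have: nbhs (g, x) (pi @^-1` U).
    exact: act_continuous (open_nbhs_nbhs (conj oU Uy)).
  by apply: filterS => -[].
apply: filterS => y KPy; apply/subbase_setP => g Kg.
by exists (pi (g, y)); [exact: KPy|exact/graph_orbit_map].
Qed.

(** The only orbit map with value [y] at [g] starts at [g^-1 y]. All axioms but the one on domains
    are read off from this image: a singleton [W] gives existence and uniqueness. *)
Lemma star_orbits pi (W : set (G * X)) :
  star [set orbit_map pi x | x in [set: X]] W =
  [set (p.1, orbit_map pi (pi (p.1^-1, p.2)%g)) | p in W].
Proof.
apply/seteqP; split=> [[g phi] /starP[[x _ <-] [y Wy /graph_orbit_map yE]]|].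
  by exists (g, y) => //=; rewrite yE -actM mulVg act1.
move=> _ [[g y] Wy <-] /=; apply/starP; split; first by eexists.
by exists y => //; apply/graph_orbit_map; rewrite -actM mulgV act1.
Qed.

Lemma orbits_compactness_axiom pi :
  compactness_axiom [set orbit_map pi x | x in [set: X]].
Proof.
move=> W cW; rewrite star_orbits; apply: (continuous_compact _ cW).
apply: continuous_subspaceT.
have cfst : continuous (@fst G X) by move=> [g x]; exact: cvg_fst.
have csnd : continuous (@snd G X) by move=> [g x]; exact: cvg_snd.
have cinv : continuous (fun p : G * X => (p.1^-1)%g).
  by move=> p; exact: continuous_comp (cfst p) (@invg_continuous G p.1).
have cact : continuous (fun p : G * X => pi (p.1^-1, p.2)%g).
  move=> p; apply: (continuous_comp (continuous_pair _ _ cinv csnd p)).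
  exact: act_continuous.
apply: (continuous_pair _ _ cfst) => p.
exact: continuous_comp (cact p) (@orbit_map_continuous pi _).
Qed.

Lemma uniqueness_axiom_inj {S phi psi} g x : uniqueness_axiom S [set: G * X] ->
  S phi -> S psi -> graph phi (g, x) -> graph psi (g, x) -> phi = psi.
Proof.
move=> /(_ g x I) uS Sphi Spsi phix psix.
have sphi : star S [set (g, x)] (g, phi) by apply/starP; split=> //; exists x.
have spsi : star S [set (g, x)] (g, psi) by apply/starP; split=> //; exists x.
case: uS => [S0|[p Sp]]; first by rewrite S0 in sphi.
by move: sphi spsi; rewrite Sp => <- [].
Qed.

Lemma axioms_action S :
  locally_compact [set: G] -> hausdorff_space G ->
  locally_compact [set: X] -> hausdorff_space X -> shift_invariant S ->
  compactness_axiom S -> existence_axiom S [set: G * X] ->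
  uniqueness_axiom S [set: G * X] -> has_domain S [set: G] ->
  exists pi : continuous_left_action G X, S = [set orbit_map pi x | x in [set: X]].
Proof.
move=> lcG hG lcX hX iS cS eS uS dS.
have /choice[s sP] x : exists phi, S phi /\ graph phi (1%g, x).
  have [[g phi] /starP[Sphi [y [-> ->] xphi]]] := eS 1%g x I.
  by exists phi.
have Ss x : S (s x) by have [] := sP x.
have s1 x : graph (s x) (1%g, x) by have [] := sP x.
have cs : continuous s.
  apply: compact_section_continuous cS _ Ss s1 => // phi psi x.
  exact: uniqueness_axiom_inj.
have /choice[f fP] (p : G * X) : exists y, graph (s p.2) (p.1, y).
  exact/graph_total/dS.
have sf g x : graph (s x) (g, f (g, x)) by exact: fP (g, x).
have cf : continuous f by exact: evaluation_continuous lcG hG cs sf.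
(* Shifting by [g] moves the value at [g] to [1], where it determines an element of [S]. Applied to
   [s x] and [h], this yields the action law [fM]. *)
have s_shift phi g x : S phi -> graph phi (g, x) -> shift_map g phi = s x.
  move=> Sphi phix; apply: (uniqueness_axiom_inj 1%g x uS) => //.
    exact: iS.
  by apply/graph_shift; rewrite mul1g.
have f1 x : f (1%g, x) = x by exact: graph_fun (sf 1%g x) (s1 x).
have fM g h x : f ((g * h)%g, x) = f (g, f (h, x)).
  have := sf g (f (h, x)); rewrite -(s_shift (s x) h) // => /graph_shift.
  exact: graph_fun.
pose pi := @ContinuousLeftAction G X f cf f1 fM.
have orbitE x : orbit_map pi x = s x.
  apply: graph_inj; apply/seteqP; split=> -[g y].
    by move=> /graph_orbit_map ->; exact: sf.
  by move=> /(graph_fun (sf g x)) <-; apply/graph_orbit_map.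
exists pi; apply/seteqP; split=> [phi Sphi|_ [x _ <-]]; last by rewrite orbitE.
have [x phix] : exists x, graph phi (1%g, x) by exact/graph_total/dS.
by exists x => //; rewrite orbitE; exact: (uniqueness_axiom_inj 1%g x uS).
Qed.

End Action.

Theorem theorem3p3 (R : realType) (G : topologicalGroupType) (X : metricType R)
    (G_locally_compact : locally_compact [set: G])
    (G_second_countable : @second_countable G)
    (G_hausdorff : hausdorff_space G)
    (X_locally_compact : locally_compact [set: X])
    (X_second_countable : @second_countable X)
    (S : set (partial_map G X))
    (S_maximal : S `<=` maximal_partial_maps G X)
    (S_invariant : shift_invariant S) :
  [/\ compactness_axiom S,
      existence_axiom S [set: G * X],
      uniqueness_axiom S [set: G * X] &
      has_domain S [set: G]]
  <->
  exists pi : continuous_left_action G X, S = [set orbit_map pi x | x in [set: X]].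
Proof.
split=> [[cS eS uS dS]|[pi ->]].
  by apply: axioms_action => //; exact: metric_hausdorff.
split; first exact: orbits_compactness_axiom.
- by move=> t x _; rewrite star_orbits image_set1; eexists; exact: erefl.
- by move=> t x _; right; rewrite star_orbits image_set1; eexists.
- by move=> _ [x _ <-].
Qed.
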